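(* Let $H$ be a finite abelian group, let $l$ be a non-negative integer, let $G = H \times (\mathbb{Z}/2\mathbb{Z})^{l}$, and let $$ M := \max \{ m \in \mathbb{N} \mid 2^{m} \text{ divides every element of } S(H)_{\mathrm{even}} \}. $$ Then $$ S(G)_{\mathrm{even}} \subset 2^{M \cdot 2^{l}}\, \mathbb{Z}. $$
   Context: For a finite group $G$, let $S(G) := \{ \det( x_{gh^{-1}} )_{g,h \in G} \mid x_g \in \mathbb{Z} \text{ for all } g \in G \}$ be the set of values of integer group determinants of $G$ (the matrix has rows and columns indexed by $G$, with $(g,h)$ entry $x_{gh^{-1}}$), and let $S(G)_{\mathrm{even}} := S(G) \cap 2\mathbb{Z}$. The symbol $\subset$ denotes (not necessarily strict) inclusion. *)

(* Defs.v *)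
From mathcomp Require Import all_boot all_order all_algebra all_fingroup.
From mathcomp Require Import boolp classical_sets.

Set Implicit Arguments.
Unset Strict Implicit.
Unset Printing Implicit Defensive.

Import GRing.Theory Num.Theory.

Local Open Scope classical_set_scope.
Local Open Scope ring_scope.

(* Rows and columns are numbered through the library's enumeration of gT; the
   determinant does not depend on that numbering. *)
Definition group_matrix (gT : finGroupType) (x : gT -> int) : 'M[int]_#|gT| :=
  \matrix_(i, j) x (enum_val i * (enum_val j)^-1)%g.

Definition group_dets (gT : finGroupType) : set int :=
  [set \det (group_matrix x) | x in [set: gT -> int]].

Definition group_dets_even (gT : finGroupType) : set int :=
  group_dets gT `&` [set d | (2 %| d)%Z].

Definition pow2_divides_even (gT : finGroupType) : pred nat :=
  fun m => `[< forall d, group_dets_even gT d -> ((2 : int) ^+ m %| d)%Z >].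

Lemma pow2_divides_even_ex (gT : finGroupType) :
  exists m, pow2_divides_even gT m.
Proof. by exists 0%N; apply/asboolP => d _; rewrite expr0 dvd1z. Qed.

(* The bound comes from x = 2 at the identity and 0 elsewhere, whose
   determinant is 2 ^+ #|gT|. *)
Lemma pow2_divides_even_le (gT : finGroupType) (m : nat) :
  pow2_divides_even gT m -> (m <= #|gT|)%N.
Proof.
move=> /asboolP/(_ (2 ^+ #|gT|)).
have gT0 : (0 < #|gT|)%N by apply/card_gt0P; exists 1%g.
rewrite dvdz_Pexp2l//; apply; split; last by rewrite /=; apply: dvdz_exp.
exists (fun g => if g == 1%g then 2 else 0) => //.
rewrite -det_scalar; congr (\det _); apply/matrixP => i j.
by rewrite !mxE -eq_mulgV1 (inj_eq enum_val_inj); case: (i == j).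
Qed.

Definition max_pow2_even (gT : finGroupType) : nat :=
  ex_maxn (pow2_divides_even_ex gT) (@pow2_divides_even_le gT).

(* Main.v *)
Require Import Defs.
From mathcomp Require Import all_boot all_order all_algebra all_fingroup.
From mathcomp Require Import boolp classical_sets.

Set Implicit Arguments.
Unset Strict Implicit.
Unset Printing Implicit Defensive.

Import GRing.Theory.

Local Open Scope classical_set_scope.
Local Open Scope ring_scope.

(** The factor [Z/2] splits group determinants.  Write an integer function on
    [K * 'Z_2] as a pair [(a, b)] of functions on [K].  Numbering the elements
    of [K * 'Z_2] by the two cosets of [K], its group matrix is the block
    matrix with [A], [B] in the first row and [B], [A] in the second, where
    [A] and [B] are the group matrices of [a] and [b]; hence
    [D(a, b) = D_K (a + b) * D_K (a - b)] ([det_group_matrix_Z2]).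
    Since [a + b] and [a - b] agree modulo 2, so do the two factors
    ([eqz_mod_det]); if the product is even then both of them are even, and
    every power of 2 dividing the even determinants of [K] divides each.  So
    if [2 ^ m] divides all even determinants of [K], then [2 ^ (2 m)] divides
    all those of [K * 'Z_2] ([pow2_divides_even_Z2]).  Starting from [H] and
    the exponent [M], adjoining [l] factors [Z/2] one at a time doubles the
    exponent [l] times. *)

(** The two numberings differ by a permutation applied to both rows and
    columns, whose signs cancel. *)
Lemma det_renumber (T : finType) (R : comNzRingType) (f : T -> T -> R)
    (m n : nat) (e : 'I_m -> T) (e' : 'I_n -> T) :
  bijective e -> bijective e' ->
  \det (\matrix_(i, j) f (e i) (e j)) = \det (\matrix_(i, j) f (e' i) (e' j)).
Proof.
move=> be be'; have eq_mn : m = n.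
  by rewrite -[m]card_ord -[n]card_ord (bij_eq_card be) (bij_eq_card be').
case: n / eq_mn e' be' => e' [g e'K gK].
have inj_ge : injective (g \o e).
  by move=> i j /= /(can_inj gK)/(bij_inj be).
pose s := perm inj_ge.
have -> : \matrix_(i, j) f (e i) (e j)
    = row_perm s (col_perm s (\matrix_(i, j) f (e' i) (e' j))).
  by apply/matrixP => i j; rewrite !mxE !permE /= !gK.
rewrite row_permE col_permE !det_mulmx !det_perm odd_permV.
by rewrite mulrCA -signr_addb addbb mulr1.
Qed.

Lemma det_block_mx_sym (R : comNzRingType) (n : nat) (A B : 'M[R]_n) :
  \det (block_mx A B B A) = \det (A + B) * \det (A - B).
Proof.
(* Add the second block row to the first, then subtract the first block column
   from the second. *)
have tri : block_mx 1%:M 1%:M 0 1%:M *m block_mx A B B A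
    *m block_mx 1%:M (- 1%:M) 0 1%:M = block_mx (A + B) 0 B (A - B).
  rewrite !mulmx_block !mul1mx !mul0mx !mulmx1 !mulmx0 !mulmxN !mulmx1.
  by rewrite !add0r !addr0 [B + A]addrC addNr [- B + A]addrC.
have /(congr1 determinant) := tri.
by rewrite !det_mulmx !det_ublock det_lblock !det1 !mulr1 mul1r.
Qed.

(** The determinant commutes with reduction modulo [p]. *)
Lemma eqz_mod_det (p n : nat) (A B : 'M[int]_n) :
  prime p -> (forall i j, (p %| A i j - B i j)%Z) ->
  (p %| \det A)%Z = (p %| \det B)%Z.
Proof.
move=> p_pr eqAB; have charp := pchar_Fp p_pr.
rewrite !(dvdz_pcharf charp) -!det_map_mx; congr (\det _ == 0).
apply/matrixP => i j; rewrite !mxE; apply/eqP.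
by rewrite -subr_eq0 -rmorphB -(dvdz_pcharf charp).
Qed.

Lemma group_dets_isog (K K' : finGroupType) (phi : K -> K') :
  bijective phi -> {morph phi : x y / (x * y)%g} ->
  group_dets K `<=` group_dets K'.
Proof.
move=> bphi phiM d [x _ <-]; case: (bphi) => psi phiK psiK.
have phiV : {morph phi : y / (y^-1)%g}.
  move=> y; apply: (mulgI (phi y)); rewrite -phiM !mulgV.
  by apply: (mulgI (phi 1%g)); rewrite -phiM !mulg1.
exists (x \o psi) => //.
have be := bij_comp bphi (enum_val_bij K).
rewrite /group_matrix.
rewrite (det_renumber (fun g h => x (psi (g * h^-1)%g)) (enum_val_bij K') be).
by congr (\det _); apply/matrixP => i j; rewrite !mxE /= -phiV -phiM phiK.
Qed.

Lemma pow2_divides_even_isog (K K' : finGroupType) (phi : K -> K') (m : nat) :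
  bijective phi -> {morph phi : x y / (x * y)%g} ->
  pow2_divides_even K' m -> pow2_divides_even K m.
Proof.
move=> bphi phiM /asboolP dvdK'; apply/asboolP => d [dK d2].
by apply: dvdK'; split=> //; exact: group_dets_isog bphi phiM _ dK.
Qed.

Lemma det_group_matrix_Z2 (K : finGroupType) (x : (K * 'Z_2)%type -> int) :
  let a g := x (g, 0) in let b g := x (g, 1) in
  \det (group_matrix x) =
    \det (group_matrix (fun g => a g + b g)) *
    \det (group_matrix (fun g => a g - b g)).
Proof.
move=> a b.
pose e (i : 'I_(#|K| + #|K|)) : (K * 'Z_2)%type :=
  match split i with inl j => (enum_val j, 0) | inr j => (enum_val j, 1) end.
have be : bijective e.
  apply: inj_card_bij; last by rewrite card_prod !card_ord muln2 addnn.
  move=> i j; rewrite /e -{2}(splitK i) -{2}(splitK j).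
  by case: (split i) => i'; case: (split j) => j' // [/enum_val_inj ->].
rewrite /group_matrix.
rewrite (det_renumber (fun g h => x (g * h^-1)%g) (enum_val_bij _) be).
have -> : \matrix_(i, j) x (e i * (e j)^-1)%g
    = block_mx (group_matrix a) (group_matrix b)
               (group_matrix b) (group_matrix a).
  apply/matrixP => i j; rewrite -(splitK i) -(splitK j).
  rewrite mxE /e !unsplitK.
  case: (split i) => i'; case: (split j) => j' /=;
    rewrite ?block_mxEul ?block_mxEur ?block_mxEdl ?block_mxEdr mxE;
    by congr (x (_, _)); apply/val_inj.
rewrite det_block_mx_sym; congr (_ * _); congr (\det _);
  by apply/matrixP => i j; rewrite !mxE.
Qed.

Lemma pow2_divides_even_Z2 (K : finGroupType) (m : nat) :
  pow2_divides_even K m -> pow2_divides_even (K * 'Z_2)%type (m * 2)%N.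
Proof.
move=> /asboolP dvdK; apply/asboolP => _ [[x _ <-]].
rewrite /= det_group_matrix_Z2.
set D := \det _; set D' := \det _.
have eqDD' : (2 %| D)%Z = (2 %| D')%Z.
  apply: (@eqz_mod_det 2) => // i j; rewrite !mxE.
  by rewrite opprD addrACA subrr add0r opprK -mulr2n -mulr_natr dvdz_mull.
have D_in : group_dets K D by eexists.
have D'_in : group_dets K D' by eexists.
rewrite dvdzE abszM Euclid_dvdM // -!(dvdzE 2) -eqDD' orbb => D2.
rewrite muln2 -addnn exprD dvdz_mul // dvdK //; split=> //=.
by rewrite -eqDD'.
Qed.

(** Splitting off the first coordinate of [{dffun 'I_l.+1 -> 'Z_2}] reduces
    [l.+1] factors to [l]. *)
Lemma pow2_divides_even_Z2n (H : finGroupType) (m l : nat) :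
  pow2_divides_even H m ->
  pow2_divides_even (H * {dffun 'I_l -> 'Z_2})%type (m * 2 ^ l)%N.
Proof.
move=> dvdH; elim: l => [|l IHl].
  rewrite muln1; apply: (@pow2_divides_even_isog _ H fst) dvdH => //.
  exists (fun h => (h, [ffun => 0])) => // -[h v] /=.
  by congr (_, _); apply/ffunP => -[].
pose phi (u : (H * {dffun 'I_l.+1 -> 'Z_2})%type) :
    ((H * {dffun 'I_l -> 'Z_2}) * 'Z_2)%type :=
  ((u.1, [ffun i => u.2 (lift ord0 i)]), u.2 ord0).
rewrite expnSr mulnA.
apply: (@pow2_divides_even_isog _ _ phi) (pow2_divides_even_Z2 IHl).
  apply: inj_card_bij; last first.
    by rewrite !card_prod !card_ffun !card_ord expnSr mulnA.
  move=> [h v] [h' v'] [/= -> /ffunP eqv eqv0]; congr (_, _).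
  apply/ffunP => i; case: (unliftP ord0 i) => [j|] -> //.
  by have := eqv j; rewrite !ffunE.
move=> [h v] [h' v']; congr ((_, _), _); last by rewrite /= ffunE.
by apply/ffunP => i; rewrite !ffunE.
Qed.

(* 'Z_2 carries its additive group law, and {dffun 'I_l -> 'Z_2} and the
   product type the componentwise ones. *)
Theorem theorem2 (H : finGroupType) (l : nat) :
  abelian [set: H]%SET ->
  let G : finGroupType := (H * {dffun 'I_l -> 'Z_2})%type in
  let M := max_pow2_even H in
  group_dets_even G `<=` [set 2 ^+ (M * 2 ^ l) * k | k in [set: int]].
Proof.
move=> _ G M d dG.
have dvdH : pow2_divides_even H M by rewrite /M /max_pow2_even; case: ex_maxnP.
have /asboolP/(_ d dG)/dvdzP[k ->] := pow2_divides_even_Z2n l dvdH.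
by exists k => //; rewrite mulrC.
Qed.
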